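(* Set $n=4$ and $Q=2$. Then the (directed) stochastic block model is identifiable, up to label switching, from the distribution of $X_{[4]}$ within the set of parameters $(\alpha,\pi)$ such that $\alpha_q>0$ for $q=1,2$ and the four coefficients of $\pi$ are not all equal. That is: if $(\alpha,\pi)$ and $(\alpha',\pi')$ both belong to this set and induce the same distribution of the adjacency matrix $X_{[4]}$, then there is a permutation $\sigma$ of $\{1,2\}$ such that $\alpha'_q=\alpha_{\sigma(q)}$ and $\pi'_{q,l}=\pi_{\sigma(q),\sigma(l)}$ for all $q,l\in\{1,2\}$.
   Context: Stochastic block model (SBM) with $Q$ classes, $n$ vertices and parameters $(\alpha,\pi)$: $\alpha=(\alpha_1,\ldots,\alpha_Q)$ is a probability vector and $\pi=(\pi_{q,l})_{1\leq q,l\leq Q}$ is a (not necessarily symmetric) matrix with entries in $[0,1]$. The labels $Z_1,\ldots,Z_n$ are i.i.d. with $\mathbb{P}(Z_i=q)=\alpha_q$. Given the labels, the entries $X_{i,j}$, $1\leq i\neq j\leq n$, of the adjacency matrix are independent, $X_{i,j}$ being Bernoulli with parameter $\pi_{Z_i,Z_j}$; moreover $X_{i,i}=0$. Only $X_{[n]}=(X_{i,j})_{1\leq i,j\leq n}$ is observed. *)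

(* Defs.v *)
From HB Require Import structures.
From mathcomp Require Import all_boot all_order all_algebra all_fingroup.
From mathcomp Require Import reals bernoulli_distribution.

Set Implicit Arguments.
Unset Strict Implicit.
Unset Printing Implicit Defensive.

Import Order.TTheory GRing.Theory Num.Theory.
Local Open Scope ring_scope.

Section StochasticBlockModel.
Variables (R : realType) (n Q : nat).
Implicit Types (alpha : 'I_Q -> R) (p : 'M[R]_Q).
Implicit Types (z : {ffun 'I_n -> 'I_Q}) (x : 'M[bool]_n).

Definition probability_vector alpha : Prop :=
  (forall q, 0 <= alpha q) /\ \sum_q alpha q = 1.

Definition sbm_parameter alpha p : Prop :=
  probability_vector alpha /\ (forall q l, 0 <= p q l <= 1).

(* P(Z = z), the labels being i.i.d. with law alpha. *)
Definition label_pmf alpha z : R := \prod_i alpha (z i).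

(* P(X = x | Z = z). The product runs over ordered pairs (directed graph),
   and the event X_{i,i} = 0 for all i has probability one. *)
Definition adjacency_cond_pmf p z x : R :=
  if [forall i, ~~ x i i]
  then \prod_i \prod_(j | j != i) bernoulli_pmf (p (z i) (z j)) (x i j)
  else 0.

(* P(X = x): only X is observed, so the labels are summed out. *)
Definition adjacency_pmf alpha p x : R :=
  \sum_(z : {ffun 'I_n -> 'I_Q}) label_pmf alpha z * adjacency_cond_pmf p z x.

End StochasticBlockModel.

Definition same_adjacency_law (R : realType) (n Q : nat)
    (alpha : 'I_Q -> R) (p : 'M[R]_Q) (alpha' : 'I_Q -> R) (p' : 'M[R]_Q) : Prop :=
  forall x : 'M[bool]_n, adjacency_pmf alpha p x = adjacency_pmf alpha' p' x.

Definition coefficients_not_all_equal (R : realType) (Q : nat) (p : 'M[R]_Q) : Prop :=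
  ~ (forall q l q' l', p q l = p q' l').

Definition admissible_parameter (R : realType) (Q : nat)
    (alpha : 'I_Q -> R) (p : 'M[R]_Q) : Prop :=
  [/\ sbm_parameter alpha p,
      forall q, 0 < alpha q &
      coefficients_not_all_equal p].

(* Main.v *)
Require Import Defs.
From mathcomp Require Import all_boot all_order all_algebra all_fingroup.
From mathcomp Require Import reals bernoulli_distribution.
From mathcomp Require Import ring.

Set Implicit Arguments.
Unset Strict Implicit.
Unset Printing Implicit Defensive.

Import Order.TTheory GRing.Theory Num.Theory.

Local Open Scope ring_scope.

(** The law of the adjacency matrix determines the expected number of copies
of any directed motif on at most four vertices: the edges being independent
given the labels, the expectation of a product of centred entries
[X_e - m], over distinct loopless pairs [e], is the sum over all labellings of
the weight of the labelling times the product of the [pi_e - m]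
(lemma [expectation_motif]).  Hence it suffices to recover [(alpha, pi)] from
such motif densities.

Let [r_q] be the mean of row [q] of [pi] with respect to [alpha], that is,
the mean out-degree of class [q].  The out-stars with [k] leaves, [k <= 3],
have density [sum_q alpha_q r_q^k].

If [r_0 <> r_1], these four moments determine the two-atom law giving mass
[alpha_q] to [r_q] ([two_atom_moment_problem]), which fixes [alpha] and the
labelling.  Hanging or not one more out-edge at each end of an edge gives
[sum_(q,l) alpha_q alpha_l pi_ql r_q^i r_l^j] with [i, j <= 1], four linear
equations with an invertible (tensor product of two Vandermonde) matrix, so
[pi] is determined too ([identifiable_of_row_means]).  If the column means
differ, the same argument applies to the graph with all arrows reversed.

There remains the case where the row means agree and the column means agree.
All are then equal to the edge density [m], and [pi - m] has zero mean along
rows and columns; for two classes this forces [pi - m = c g g^T] with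
[g = (alpha_1, - alpha_0)], see [balanced_kernel_rank1].  With
[lambda = c alpha_0 alpha_1], which is nonzero because the entries of [pi] are
not all equal, the densities of motifs for [pi - m] are as follows: the double
edge gives [lambda^2], the directed triangle [lambda^3], and the triangle with
one edge doubled [lambda^4 (alpha_0 - alpha_1)^2 / (alpha_0 alpha_1)].
The first two determine [lambda]; since
[(alpha_0 - alpha_1)^2 = 1 - 4 alpha_0 alpha_1], the third one determines
[alpha_0 alpha_1], hence [alpha] up to a swap ([identifiable_of_balanced]).
Doubling an edge is possible because the graph is directed. *)

(** * Motif densities are determined by the law of the graph *)

Section MotifDensity.
Variables (R : realType) (n Q : nat).
Implicit Types (alpha : 'I_Q -> R) (p w : 'M[R]_Q) (z : {ffun 'I_n -> 'I_Q}).
Implicit Types (s : seq ('I_n * 'I_n)).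

(** This is the usual homomorphism density, with the list [s] of arrows as
pattern and [w] as kernel; [w] is an arbitrary matrix because it will be used
on centred kernels, whose entries need not lie in [[0, 1]]. *)
Definition motif_density alpha w s : R :=
  \sum_(z : {ffun 'I_n -> 'I_Q})
    label_pmf alpha z * \prod_(e <- s) w (z e.1) (z e.2).

Definition simple_motif s := uniq s && all (fun e => e.1 != e.2) s.

(** Absorbing the condition on the diagonal into the product makes all [n^2]
entries independent given the labels, so that sums over adjacency matrices
factor. *)
Lemma adjacency_cond_pmfE p z (x : 'M[bool]_n) :
  adjacency_cond_pmf p z x =
  \prod_(e : 'I_n * 'I_n)
     if e.1 == e.2 then (~~ x e.1 e.2)%:R
     else bernoulli_pmf (p (z e.1) (z e.2)) (x e.1 e.2).
Proof.
rewrite -(pair_bigA _ (fun i j => if i == j then (~~ x i j)%:R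
                          else bernoulli_pmf (p (z i) (z j)) (x i j))) /=.
rewrite /adjacency_cond_pmf; case: ifP => [/forallP xii|/negbT].
  apply: eq_bigr => i _; rewrite [RHS](bigD1 i) //= eqxx xii mul1r.
  by apply: eq_bigr => j; rewrite eq_sym => /negbTE ->.
rewrite negb_forall => /existsP [i xii]; apply/esym/eqP.
rewrite prodf_seq_eq0; apply/hasP; exists i; first exact: mem_index_enum.
by rewrite /= (bigD1 i) //= eqxx (negbTE xii) mul0r.
Qed.

Lemma sum_prod_entries (F : 'I_n * 'I_n -> bool -> R) :
  \sum_(x : 'M[bool]_n) \prod_e F e (x e.1 e.2) =
  \prod_e (F e true + F e false).
Proof.
transitivity (\prod_e \sum_(b : bool) F e b); last first.
  by apply: eq_bigr => e _; rewrite big_bool.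
rewrite bigA_distr_bigA /=.
rewrite (reindex (fun f : {ffun 'I_n * 'I_n -> bool} => \matrix_(i, j) f (i, j))).
  by apply: eq_bigr => f _; apply: eq_bigr => -[i j] _; rewrite mxE.
exists (fun x : 'M[bool]_n => [ffun e => x e.1 e.2]) => y _.
  by apply/ffunP => -[i j]; rewrite ffunE mxE.
by apply/matrixP => i j; rewrite mxE ffunE.
Qed.

(** Each entry contributes at most one factor since [s] is duplicate-free, so
conditional independence turns the expectation of the product into the product
of the expectations [p q l - m]. *)
Lemma expectation_motif alpha p (m : R) s : simple_motif s ->
  \sum_(x : 'M[bool]_n)
     adjacency_pmf alpha p x * \prod_(e <- s) ((x e.1 e.2)%:R - m) =
  motif_density alpha (p - const_mx m) s.
Proof.
case/andP => s_uniq /allP s_loopless.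
under eq_bigr do rewrite mulr_suml.
rewrite exchange_big /=; apply: eq_bigr => z _.
under eq_bigr do rewrite -mulrA.
rewrite -mulr_sumr; congr (_ * _).
pose F (e : 'I_n * 'I_n) (b : bool) : R :=
  (if e.1 == e.2 then (~~ b)%:R else bernoulli_pmf (p (z e.1) (z e.2)) b)
  * (if e \in s then b%:R - m else 1).
transitivity (\sum_(x : 'M[bool]_n) \prod_e F e (x e.1 e.2)).
  apply: eq_bigr => x _.
  rewrite big_split adjacency_cond_pmfE (big_uniq s) //=.
  by rewrite [X in _ * X = _]big_mkcond.
rewrite sum_prod_entries [RHS]big_uniq //= [RHS]big_mkcond.
apply: eq_bigr => e _; rewrite /F /bernoulli_pmf !mxE.
case: ifPn => e_loop; case: ifP => [/s_loopless e_simple|_] /=.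
- by rewrite e_loop in e_simple.
all: ring.
Qed.

Lemma same_law_motif_density alpha p alpha' p' (m : R) s :
    same_adjacency_law n alpha p alpha' p' -> simple_motif s ->
  motif_density alpha (p - const_mx m) s =
  motif_density alpha' (p' - const_mx m) s.
Proof.
move=> same_law s_simple; rewrite -!expectation_motif //.
by apply: eq_bigr => x _; rewrite same_law.
Qed.

(** Transposing the kernel reverses all the arrows of the graph, so statements
on rows transfer to columns. *)
Lemma adjacency_cond_pmf_tr p z (x : 'M[bool]_n) :
  adjacency_cond_pmf p^T z x = adjacency_cond_pmf p z x^T.
Proof.
rewrite !adjacency_cond_pmfE (reindex_inj (h := fun e => (e.2, e.1))) /=; last first.
  by move=> [i j] [k l] [-> ->].
by apply: eq_bigr => e _; rewrite !mxE eq_sym.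
Qed.

Lemma same_law_tr alpha p alpha' p' :
    same_adjacency_law n alpha p alpha' p' ->
  same_adjacency_law n alpha p^T alpha' p'^T.
Proof.
have pmf_tr a q x : adjacency_pmf a q^T x = @adjacency_pmf R n Q a q x^T.
  by apply: eq_bigr => z _; rewrite adjacency_cond_pmf_tr.
by move=> same_law x; rewrite !pmf_tr.
Qed.

End MotifDensity.

(** * Densities of motifs on four vertices for two classes *)

Section TwoClasses.
Variable R : realType.
Implicit Types (alpha r : 'I_2 -> R) (p w : 'M[R]_2).

Lemma sum_ord2 (F : 'I_2 -> R) : \sum_q F q = F 0 + F 1.
Proof.
rewrite !big_ord_recl big_ord0 addr0; congr (F _ + F _); exact: val_inj.
Qed.

Lemma second_weightE alpha : \sum_q alpha q = 1 -> alpha 1 = 1 - alpha 0.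
Proof. by rewrite sum_ord2 => <-; rewrite addrC addKr. Qed.

Lemma ord2P (P : 'I_2 -> Prop) : P 0 -> P 1 -> forall q, P q.
Proof.
move=> P0 P1 q; have [->|q_neq0] := eqVneq q 0; first by [].
suff -> : q = 1 by [].
by apply: val_inj; move: q q_neq0 => -[[|[|k]]].
Qed.

Definition v0 : 'I_4 := @Ordinal 4 0 isT.
Definition v1 : 'I_4 := @Ordinal 4 1 isT.
Definition v2 : 'I_4 := @Ordinal 4 2 isT.
Definition v3 : 'I_4 := @Ordinal 4 3 isT.

(** Evaluates a density once the contribution of a labelling is written as a
function of the labels of the four vertices; the later computations are then
polynomial identities. *)
Lemma motif_density4 (Q : nat) (alpha : 'I_Q -> R) (w : 'M[R]_Q) s
    (G : 'I_Q -> 'I_Q -> 'I_Q -> 'I_Q -> R) :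
    (forall z : {ffun 'I_4 -> 'I_Q},
       \prod_(e <- s) w (z e.1) (z e.2) = G (z v0) (z v1) (z v2) (z v3)) ->
  motif_density alpha w s =
  \sum_a \sum_b \sum_c \sum_d
     alpha a * alpha b * alpha c * alpha d * G a b c d.
Proof.
move=> prodE; rewrite pair_bigA pair_bigA pair_bigA /=.
rewrite [LHS](reindex (fun t : 'I_Q * 'I_Q * 'I_Q * 'I_Q =>
  [ffun i => tnth [tuple t.1.1.1; t.1.1.2; t.1.2; t.2] i])) /=.
  apply: eq_bigr => -[[[a b] c] d] _; rewrite prodE !ffunE /=.
  rewrite /label_pmf !big_ord_recl big_ord0 !ffunE.
  by rewrite /tnth /= mulr1 !mulrA.
exists (fun z : {ffun 'I_4 -> 'I_Q} => (z v0, z v1, z v2, z v3)) => [t|z] _.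
  by rewrite !ffunE; case: t => [[[a b] c] d].
by apply/ffunP => -[[|[|[|[|k]]]] k_lt] //; rewrite ffunE /tnth /=;
   congr (z _); apply: val_inj.
Qed.

Definition row_mean alpha w q : R := \sum_l alpha l * w q l.

(** Out-star with centre [v0]. *)
Definition star k : seq ('I_4 * 'I_4) := take k [:: (v0, v1); (v0, v2); (v0, v3)].

Lemma star_density alpha w k : \sum_q alpha q = 1 -> (k <= 3)%N ->
  motif_density alpha w (star k) =
  \sum_q alpha q * row_mean alpha w q ^+ k.
Proof.
move=> /second_weightE alpha1E; rewrite /row_mean !sum_ord2.
case: k => [|[|[|[|//]]]] _.
- rewrite (@motif_density4 _ _ _ _ (fun _ _ _ _ => 1)); last first.
    by move=> z; rewrite big_nil.
  rewrite !sum_ord2 alpha1E; ring.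
- rewrite (@motif_density4 _ _ _ _ (fun a b _ _ => w a b)); last first.
    by move=> z; rewrite !big_cons big_nil mulr1.
  rewrite !sum_ord2 alpha1E; ring.
- rewrite (@motif_density4 _ _ _ _ (fun a b c _ => w a b * w a c)); last first.
    by move=> z; rewrite !big_cons big_nil mulr1.
  rewrite !sum_ord2 alpha1E; ring.
- rewrite (@motif_density4 _ _ _ _ (fun a b c d => w a b * (w a c * w a d))); last first.
    by move=> z; rewrite !big_cons big_nil mulr1.
  rewrite !sum_ord2 alpha1E; ring.
Qed.

(** The arrow from [v0] to [v1], with one more out-arrow at its source when [i]
holds and one more at its target when [j] holds. *)
Definition pendant_edge (i j : bool) : seq ('I_4 * 'I_4) :=
  (v0, v1) :: nseq i (v0, v2) ++ nseq j (v1, v3).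

Lemma pendant_edge_density alpha w (i j : bool) : \sum_q alpha q = 1 ->
  motif_density alpha w (pendant_edge i j) =
  \sum_q \sum_l alpha q * alpha l * w q l
                * row_mean alpha w q ^+ i * row_mean alpha w l ^+ j.
Proof.
move=> /second_weightE alpha1E; rewrite /row_mean !sum_ord2.
rewrite (@motif_density4 _ _ _ _
  (fun a b c d => w a b * (w a c ^+ i * w b d ^+ j))); last first.
  by case: i; case: j => z; rewrite !big_cons big_nil ?mulr1 ?mul1r.
by case: i; case: j; rewrite !sum_ord2 alpha1E; ring.
Qed.

(** * The two-atom moment problem *)

(** Invertibility of the 2 x 2 Vandermonde matrix; the exponents range over the
booleans, seen as 0 and 1. *)
Lemma sum_affine_eq0 r (d : 'I_2 -> R) : r 0 != r 1 ->
  (forall i : bool, \sum_q d q * r q ^+ i = 0) -> forall q, d q = 0.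
Proof.
rewrite -subr_eq0 => r_neq moments.
have := moments false; have := moments true.
rewrite !sum_ord2 !expr1 !mulr1 => m1 m0.
have d0 : d 0 = 0.
  apply: (mulIf r_neq); rewrite mul0r.
  transitivity (d 0 * r 0 + d 1 * r 1 - (d 0 + d 1) * r 1); first by ring.
  by rewrite m1 m0 mul0r subrr.
by apply: ord2P => //; rewrite d0 add0r in m0.
Qed.

Lemma two_atom_variance alpha r : \sum_q alpha q = 1 ->
  \sum_q alpha q * r q ^+ 2 - (\sum_q alpha q * r q ^+ 1) ^+ 2 =
  alpha 0 * alpha 1 * (r 0 - r 1) ^+ 2.
Proof.
by move=> /second_weightE alpha1E; rewrite !sum_ord2 alpha1E; ring.
Qed.

(** With positive weights, the variance vanishes exactly when the atoms
coincide. *)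
Lemma two_atom_moments_neq alpha r alpha' r' :
    (forall q, 0 < alpha q) -> \sum_q alpha q = 1 -> \sum_q alpha' q = 1 ->
    (forall k, (k <= 3)%N ->
       \sum_q alpha q * r q ^+ k = \sum_q alpha' q * r' q ^+ k) ->
  r 0 != r 1 -> r' 0 != r' 1.
Proof.
move=> alpha_gt0 sum1 sum1' moments; apply: contraNN => /eqP r'_eq.
have := two_atom_variance r' sum1'.
rewrite -!moments // two_atom_variance // r'_eq subrr expr0n mulr0 => /eqP.
by rewrite !mulf_eq0 subr_eq0 !(gt_eqF (alpha_gt0 _)) /= orbb.
Qed.

(** The polynomial [(x - r 0) (x - r 1)] annihilates the first law, so, the
moments being equal, the weights [alpha' q * (r' q - r 0) * (r' q - r 1)] have
vanishing moments of order 0 and 1 on the distinct atoms [r' 0], [r' 1]; they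
are zero and each [r' q] is [r 0] or [r 1].  Third moments are needed as the
polynomial has degree 2 and is tested against degree 1. *)
Lemma two_atom_moment_problem alpha r alpha' r' :
    (forall q, 0 < alpha q) -> (forall q, 0 < alpha' q) ->
    \sum_q alpha q = 1 -> \sum_q alpha' q = 1 ->
    (forall k, (k <= 3)%N ->
       \sum_q alpha q * r q ^+ k = \sum_q alpha' q * r' q ^+ k) ->
    r 0 != r 1 ->
  exists s : 'S_2, forall q, alpha' q = alpha (s q) /\ r' q = r (s q).
Proof.
move=> alpha_gt0 alpha'_gt0 sum1 sum1' moments r_neq.
have r'_neq : r' 0 != r' 1 by apply: two_atom_moments_neq moments r_neq.
have atoms q : (r' q == r 0) || (r' q == r 1).
  suff /eqP : alpha' q * ((r' q - r 0) * (r' q - r 1)) = 0.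
    by rewrite !mulf_eq0 (gt_eqF (alpha'_gt0 _)) /= !subr_eq0.
  move: q; apply: (sum_affine_eq0 r'_neq) => i.
  transitivity (\sum_q alpha q * ((r q - r 0) * (r q - r 1)) * r q ^+ i).
    have expand a (x : 'I_2 -> R) :
        \sum_q a q * ((x q - r 0) * (x q - r 1)) * x q ^+ i =
        \sum_q a q * x q ^+ i.+2 - (r 0 + r 1) * \sum_q a q * x q ^+ i.+1
        + r 0 * r 1 * \sum_q a q * x q ^+ i.
      by rewrite !sum_ord2 !exprS; ring.
    by rewrite !expand -!moments //; case: (i).
  by rewrite sum_ord2 !subrr; ring.
have [s r'E] : exists s : 'S_2, forall q, r' q = r (s q).
  case/orP: (atoms 0) (atoms 1) => /eqP r'0 /orP[] /eqP r'1.
  - by rewrite r'0 r'1 eqxx in r'_neq.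
  - by exists 1%g; apply: ord2P; rewrite perm1.
  - by exists (tperm 0 1); apply: ord2P; rewrite ?tpermL ?tpermR.
  - by rewrite r'0 r'1 eqxx in r'_neq.
exists s => q; split=> //; apply/eqP; rewrite -subr_eq0; apply/eqP.
move: q; apply: (sum_affine_eq0 r'_neq) => i.
under eq_bigr do rewrite mulrBl {2}r'E.
rewrite sumrB -moments; last by case: i.
by rewrite [X in X - _](reindex_inj (@perm_inj _ s)) subrr.
Qed.

(** * Classes with distinct mean degrees *)

Lemma same_law_uncentred_density alpha p alpha' p' (s : seq ('I_4 * 'I_4)) :
    same_adjacency_law 4 alpha p alpha' p' -> simple_motif s ->
  motif_density alpha p s = motif_density alpha' p' s.
Proof.
move=> same_law s_simple; have := same_law_motif_density 0 same_law s_simple.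
by rewrite (_ : const_mx 0 = 0) ?subr0 //; apply/matrixP => i j; rewrite !mxE.
Qed.

Lemma same_row_mean_moments alpha p alpha' p' :
    \sum_q alpha q = 1 -> \sum_q alpha' q = 1 ->
    same_adjacency_law 4 alpha p alpha' p' ->
  forall k, (k <= 3)%N ->
    \sum_q alpha q * row_mean alpha p q ^+ k =
    \sum_q alpha' q * row_mean alpha' p' q ^+ k.
Proof.
move=> sum1 sum1' same_law k k_le3.
rewrite -!star_density // (same_law_uncentred_density same_law) //.
by case: k k_le3 => [|[|[|[|]]]].
Qed.

Lemma equal_row_means_transfer alpha p alpha' p' :
    (forall q, 0 < alpha' q) ->
    \sum_q alpha q = 1 -> \sum_q alpha' q = 1 ->
    same_adjacency_law 4 alpha p alpha' p' ->
    row_mean alpha p 0 = row_mean alpha p 1 ->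
  row_mean alpha' p' 0 = row_mean alpha' p' 1.
Proof.
move=> alpha'_gt0 sum1 sum1' same_law /eqP row_eq; apply/eqP.
apply: contraLR row_eq; apply: (two_atom_moments_neq alpha'_gt0 sum1' sum1) => k k_le3.
by rewrite -(same_row_mean_moments sum1 sum1' same_law).
Qed.

(** Once the row means are matched by [s], the differences
[p' q l - p (s q) (s l)], weighted by [alpha' q * alpha' l], solve a homogeneous
system: the tensor square of an invertible Vandermonde system. *)
Lemma identifiable_of_row_means alpha p alpha' p' :
    (forall q, 0 < alpha q) -> (forall q, 0 < alpha' q) ->
    \sum_q alpha q = 1 -> \sum_q alpha' q = 1 ->
    same_adjacency_law 4 alpha p alpha' p' ->
    row_mean alpha p 0 != row_mean alpha p 1 ->
  exists s : 'S_2,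
    (forall q, alpha' q = alpha (s q)) /\
    (forall q l, p' q l = p (s q) (s l)).
Proof.
move=> alpha_gt0 alpha'_gt0 sum1 sum1' same_law r_neq.
have moments := same_row_mean_moments sum1 sum1' same_law.
have r'_neq := two_atom_moments_neq alpha_gt0 sum1 sum1' moments r_neq.
have [s sE] :=
  two_atom_moment_problem alpha_gt0 alpha'_gt0 sum1 sum1' moments r_neq.
have alpha'E q : alpha' q = alpha (s q) by case: (sE q).
have r'E q : row_mean alpha' p' q = row_mean alpha p (s q) by case: (sE q).
exists s; split=> // q l.
pose d q l := alpha' q * alpha' l * (p' q l - p (s q) (s l)).
suff /eqP : d q l = 0.
  by rewrite !mulf_eq0 !(gt_eqF (alpha'_gt0 _)) /= subr_eq0 => /eqP.
have d_moments (i j : bool) :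
    \sum_q (\sum_l d q l * row_mean alpha' p' l ^+ j)
           * row_mean alpha' p' q ^+ i = 0.
  have := same_law_uncentred_density (s := pendant_edge i j) same_law.
  rewrite !pendant_edge_density // => /(_ _) density_eq.
  transitivity
    (\sum_q \sum_l alpha' q * alpha' l * p' q l
        * row_mean alpha' p' q ^+ i * row_mean alpha' p' l ^+ j
     - \sum_q \sum_l alpha q * alpha l * p q l
        * row_mean alpha p q ^+ i * row_mean alpha p l ^+ j); last first.
    by rewrite density_eq ?subrr //; case: (i); case: (j).
  rewrite [X in _ - X](reindex_inj (@perm_inj _ s)) -sumrB.
  apply: eq_bigr => q' _; rewrite mulr_suml.
  rewrite [X in _ - X](reindex_inj (@perm_inj _ s)) -sumrB.
  by apply: eq_bigr => l' _; rewrite -!alpha'E -!r'E /d; ring.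
move: l; apply: (sum_affine_eq0 r'_neq) => j.
by move: q; apply: (sum_affine_eq0 r'_neq) => i.
Qed.

(** * Classes with equal mean degrees *)

(** Spans the line of vectors of mean zero for [alpha]. *)
Definition contrast alpha (q : 'I_2) : R := if q == 0 then alpha 1 else - alpha 0.

(** All rows and all columns of [w] are orthogonal to [alpha], hence multiples of
[contrast alpha].  The value of [c] is read off the entry [w 0 1]. *)
Lemma balanced_kernel_rank1 alpha w :
    (forall q, 0 < alpha q) ->
    (forall q, row_mean alpha w q = 0) -> (forall q, row_mean alpha w^T q = 0) ->
  exists c, forall q l, w q l = c * contrast alpha q * contrast alpha l.
Proof.
move=> alpha_gt0 rows cols.
have a0 : alpha 0 != 0 by rewrite gt_eqF.
have a1 : alpha 1 != 0 by rewrite gt_eqF.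
have := (rows 0, rows 1, cols 1).
rewrite /row_mean !sum_ord2 !mxE => -[[row0 row1] col1].
exists (- w 0 1 / (alpha 0 * alpha 1)).
have w00 : w 0 0 = - (alpha 1 * w 0 1) / alpha 0.
  by rewrite -(addr0_eq row0) opprK [RHS]mulrC mulKf.
have w11 : w 1 1 = - (alpha 0 * w 0 1) / alpha 1.
  by rewrite (addr0_eq col1) [RHS]mulrC mulKf.
have w10 : w 1 0 = w 0 1.
  apply: (mulfI a0); apply: (addIr (alpha 1 * w 1 1)).
  by rewrite row1 col1.
rewrite /contrast.
by do 2!apply: ord2P; rewrite /= ?w00 ?w10 ?w11; field; rewrite a0 a1.
Qed.

Definition double_edge : seq ('I_4 * 'I_4) := [:: (v0, v1); (v1, v0)].
Definition triangle : seq ('I_4 * 'I_4) := [:: (v0, v1); (v1, v2); (v2, v0)].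

(** For a rank-one kernel the density factors over the vertices: a vertex of
total degree [d] contributes the mean of the [d]-th power of the contrast, that
is [alpha 0 * alpha 1] for [d = 2] and
[alpha 0 * alpha 1 * (alpha 1 - alpha 0)] for [d = 3].  Degree three
vertices, as in the triangle with a doubled edge, are what tells the weights
apart. *)
Lemma rank1_densities alpha w c :
    \sum_q alpha q = 1 ->
    (forall q l, w q l = c * contrast alpha q * contrast alpha l) ->
  let lambda := c * (alpha 0 * alpha 1) in
  [/\ motif_density alpha w double_edge = lambda ^+ 2,
      motif_density alpha w triangle = lambda ^+ 3 &
      alpha 0 * alpha 1 * motif_density alpha w ((v1, v0) :: triangle) =
      lambda ^+ 4 * (alpha 0 - alpha 1) ^+ 2].
Proof.
move=> /second_weightE alpha1E wE lambda.
split.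
- rewrite (@motif_density4 _ _ _ _ (fun a b _ _ => w a b * w b a)).
    by rewrite !sum_ord2 !wE /contrast /= /lambda alpha1E; ring.
  by move=> z; rewrite !big_cons big_nil mulr1.
- rewrite (@motif_density4 _ _ _ _ (fun a b c _ => w a b * (w b c * w c a))).
    by rewrite !sum_ord2 !wE /contrast /= /lambda alpha1E; ring.
  by move=> z; rewrite !big_cons big_nil mulr1.
- rewrite (@motif_density4 _ _ _ _
    (fun a b c _ => w b a * (w a b * (w b c * w c a)))).
    by rewrite !sum_ord2 !wE /contrast /= /lambda alpha1E; ring.
  by move=> z; rewrite !big_cons big_nil mulr1.
Qed.

Lemma equal_row_means alpha w m : \sum_q alpha q = 1 ->
  row_mean alpha w 0 = row_mean alpha w 1 ->
  motif_density alpha w (star 1) = m ->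
  forall q, row_mean alpha (w - const_mx m) q = 0.
Proof.
move=> sum1 row_eq; rewrite star_density // sum_ord2 !expr1 -row_eq -mulrDl.
rewrite -sum_ord2 sum1 mul1r => mE.
have rowE q : row_mean alpha w q = m by move: q; apply: ord2P; rewrite -?row_eq.
move=> q; rewrite /row_mean.
under eq_bigr do rewrite !mxE mulrBr.
by rewrite sumrB -mulr_suml sum1 mul1r [X in X - _]rowE subrr.
Qed.

Lemma two_class_weights alpha alpha' :
    \sum_q alpha q = 1 -> \sum_q alpha' q = 1 ->
    alpha 0 * alpha 1 = alpha' 0 * alpha' 1 ->
  alpha' =1 alpha \/ alpha' 0 = alpha 1 /\ alpha' 1 = alpha 0.
Proof.
move=> /second_weightE alpha1E /second_weightE alpha1E' prod_eq.
have : (alpha' 0 - alpha 0) * (alpha' 0 - alpha 1) = 0.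
  transitivity (alpha 0 * alpha 1 - alpha' 0 * alpha' 1).
    by rewrite alpha1E alpha1E'; ring.
  by rewrite prod_eq subrr.
move/eqP; rewrite mulf_eq0 !subr_eq0 => /orP[] /eqP alpha0E.
  by left; apply: ord2P; rewrite // alpha1E' alpha1E alpha0E.
by right; split=> //; rewrite alpha1E' alpha0E alpha1E subKr.
Qed.

Lemma identifiable_of_balanced alpha p alpha' p' :
    (forall q, 0 < alpha q) -> (forall q, 0 < alpha' q) ->
    \sum_q alpha q = 1 -> \sum_q alpha' q = 1 ->
    coefficients_not_all_equal p ->
    same_adjacency_law 4 alpha p alpha' p' ->
    row_mean alpha p 0 = row_mean alpha p 1 ->
    row_mean alpha p^T 0 = row_mean alpha p^T 1 ->
    row_mean alpha' p' 0 = row_mean alpha' p' 1 ->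
    row_mean alpha' p'^T 0 = row_mean alpha' p'^T 1 ->
  exists s : 'S_2,
    (forall q, alpha' q = alpha (s q)) /\
    (forall q l, p' q l = p (s q) (s l)).
Proof.
move=> alpha_gt0 alpha'_gt0 sum1 sum1' p_nonconst same_law rowP colP rowP' colP'.
have same_density := same_law_motif_density _ same_law.
pose m := motif_density alpha p (star 1).
have star1_tr (a : 'I_2 -> R) (q : 'M[R]_2) : \sum_l a l = 1 ->
    motif_density a q^T (star 1) = motif_density a q (star 1).
  move=> a_sum; rewrite !star_density // /row_mean !sum_ord2 !mxE; ring.
have m' : motif_density alpha' p' (star 1) = m.
  by rewrite -(same_law_uncentred_density same_law).
have centered_tr (q : 'M[R]_2) : (q - const_mx m)^T = q^T - const_mx m.
  by apply/matrixP => i j; rewrite !mxE.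
have [c wE] : exists c, forall q l,
    (p - const_mx m) q l = c * contrast alpha q * contrast alpha l.
  apply: balanced_kernel_rank1; rewrite ?centered_tr //.
    exact: equal_row_means.
  by apply: equal_row_means; rewrite ?star1_tr.
have [c' wE'] : exists c', forall q l,
    (p' - const_mx m) q l = c' * contrast alpha' q * contrast alpha' l.
  apply: balanced_kernel_rank1; rewrite ?centered_tr //.
    exact: equal_row_means.
  by apply: equal_row_means; rewrite ?star1_tr.
have [double triangleE chorded] := rank1_densities sum1 wE.
have [double' triangleE' chorded'] := rank1_densities sum1' wE'.
move: double triangleE chorded.
rewrite !same_density // double' triangleE' => lambda2 lambda3 chorded.
pose lambda := c * (alpha 0 * alpha 1).
pose lambda' := c' * (alpha' 0 * alpha' 1).
rewrite -/lambda -/lambda' in lambda2 lambda3 chorded chorded'.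
have prod_neq0 : alpha 0 * alpha 1 != 0 by rewrite mulf_neq0 ?gt_eqF.
have lambda_neq0 : lambda != 0.
  apply: contra_notN p_nonconst; rewrite mulf_eq0 (negbTE prod_neq0) orbF => /eqP c0.
  have pE q l : p q l = m.
    by apply/eqP; rewrite -subr_eq0; move: (wE q l); rewrite !mxE c0 !mul0r => ->.
  by move=> q l q' l'; rewrite !pE.
(* A nonzero number is the quotient of its cube by its square. *)
have lambdaE : lambda' = lambda.
  apply: (mulfI (expf_neq0 2 lambda_neq0)).
  by rewrite -exprSr -lambda3 -lambda2 -exprSr.
(* As the weights sum to 1, the square of their difference is 1 minus four times
   their product. *)
have prodE : alpha 0 * alpha 1 = alpha' 0 * alpha' 1.
  apply: (mulfI (expf_neq0 4 lambda_neq0)).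
  have alpha1E := second_weightE sum1; have alpha1E' := second_weightE sum1'.
  set D := motif_density _ _ _ in chorded chorded'.
  transitivity (alpha 0 * alpha 1 * (alpha' 0 * alpha' 1 * D)
                + 4 * lambda ^+ 4 * (alpha 0 * alpha 1) * (alpha' 0 * alpha' 1)).
    by rewrite chorded' lambdaE alpha1E'; ring.
  by rewrite mulrCA chorded alpha1E; ring.
have cE : c' = c.
  by apply: (mulIf prod_neq0); rewrite [in LHS]prodE.
have pE q l : p q l = m + c * contrast alpha q * contrast alpha l.
  by rewrite -wE !mxE addrCA subrr addr0.
have pE' q l : p' q l = m + c * contrast alpha' q * contrast alpha' l.
  by rewrite -cE -wE' !mxE addrCA subrr addr0.
(* Swapping the weights negates the contrast up to the swap, which leaves the
   rank-one kernel unchanged. *)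
have [alphaE|[alpha0E alpha1E]] := two_class_weights sum1 sum1' prodE.
  exists 1%g; split=> q; rewrite ?perm1 // => l.
  by rewrite !perm1 pE pE' /contrast !alphaE.
exists (tperm 0 1); split; first by apply: ord2P; rewrite ?tpermL ?tpermR.
have contrastE q : contrast alpha' q = - contrast alpha (tperm 0 1 q).
  move: q; apply: ord2P; rewrite ?tpermL ?tpermR /contrast /= ?opprK //.
  by rewrite alpha0E.
by move=> q l; rewrite pE pE' !contrastE !mulrN mulNr opprK.
Qed.

End TwoClasses.

Theorem theorem2p2 (R : realType)
    (alpha alpha' : 'I_2 -> R) (p p' : 'M[R]_2) :
  admissible_parameter alpha p ->
  admissible_parameter alpha' p' ->
  same_adjacency_law 4 alpha p alpha' p' ->
  exists s : 'S_2,
    (forall q : 'I_2, alpha' q = alpha (s q)) /\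
    (forall q l : 'I_2, p' q l = p (s q) (s l)).
Proof.
move=> [[[_ sum1] _] alpha_gt0 p_nonconst] [[[_ sum1'] _] alpha'_gt0 _] same_law.
have [row_eq|] := eqVneq (row_mean alpha p 0) (row_mean alpha p 1); last first.
  exact: identifiable_of_row_means.
have [col_eq|col_neq] := eqVneq (row_mean alpha p^T 0) (row_mean alpha p^T 1);
    last first.
  have [s [alphaE p_trE]] := identifiable_of_row_means alpha_gt0 alpha'_gt0
    sum1 sum1' (same_law_tr same_law) col_neq.
  by exists s; split=> // q l; have := p_trE l q; rewrite !mxE.
have row_eq' := equal_row_means_transfer alpha'_gt0 sum1 sum1' same_law row_eq.
have col_eq' := equal_row_means_transfer alpha'_gt0 sum1 sum1'
  (same_law_tr same_law) col_eq.
exact: identifiable_of_balanced.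
Qed.
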